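(* There exists a family of c-connected flat clustered graphs $C(G,T)$ with planar underlying graph $G$ on $n$ vertices, for arbitrarily large $n$, such that $\beta\in\Omega(n)$ in every $\langle 0,\beta,0\rangle$-drawing of $C(G,T)$.
   Context: A clustered graph $C(G,T)$ consists of a graph $G$ and a rooted tree $T$ whose leaves are exactly the vertices of $G$; each internal node $\mu$ of $T$ is a cluster, identified with the set of leaves of its subtree. $C(G,T)$ is c-connected if for every cluster the subgraph of $G$ induced by its vertices is connected; it is flat if no cluster other than the root contains another cluster. A drawing of $C(G,T)$ maps vertices to distinct points, edges to open curves between their endpoints, and each cluster $\mu$ to a simple closed region $R(\mu)$ containing all and only the vertices of $\mu$, with $R(\nu)\supseteq R(\mu)$ whenever $\mu$ is a descendant of $\nu$. Intersections among curves are isolated points, no three curves meet at a point, and two curves alternate around each intersection point. Edge-edge crossings are crossings between two edges; an edge crossing the boundary of $R(\mu)$ exactly $k$ times contributes $\lfloor k/2\rfloor$ edge-region crossings; for clusters $\mu,\nu$ neither an ancestor of the other, the number of region-region crossings is the number of connected components of $R(\mu)\setminus R(\nu)$ minus one. A $\langle 0,\beta,0\rangle$-drawing is a drawing with exactly $\beta$ edge-region crossings and no edge-edge or region-region crossings. *)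

(* Defs.v *)
From HB Require Import structures.
From mathcomp Require Import all_boot all_order all_algebra.
From mathcomp Require Import all_classical all_reals all_analysis.

Set Implicit Arguments.
Unset Strict Implicit.
Unset Printing Implicit Defensive.

Import Order.TTheory GRing.Theory Num.Theory.
Import numFieldNormedType.Exports.

Record sgraph := SGraph {
  vertex : finType;
  adj : rel vertex;
  adj_sym : symmetric adj;
  adj_irr : irreflexive adj }.

Definition edge_set (G : sgraph) : {set {set vertex G}} :=
  [set e : {set vertex G} |
    [exists u, [exists v, adj u v && (e == [set u; v]%SET)]]]%SET.

Definition edge (G : sgraph) : finType := {e : {set vertex G} | e \in edge_set G}.

(* The nodes of the rooted tree T are [vertex cg_graph + cluster]: the first
   summand consists of the leaves, the second one of the internal nodes, i.e.,
   the clusters.  [parent] maps every node other than the root to its parent; its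
   value at the root is the root itself, by convention.  By [cluster_child]
   internal nodes are not leaves. *)
Record clustered_graph := ClusteredGraph {
  cg_graph :> sgraph;
  cluster : finType;
  root : cluster;
  parent : vertex cg_graph + cluster -> cluster;
  parent_root : parent (inr root) = root;
  parent_to_root : forall mu, fconnect (fun nu => parent (inr nu)) mu root;
  cluster_child : forall mu, exists2 x, x != inr root & parent x = mu }.

(* [descendant mu nu]: mu lies in the subtree of T rooted at nu (possibly
   mu = nu). *)
Definition descendant (C : clustered_graph) (mu nu : cluster C) : bool :=
  fconnect (fun x : cluster C => parent (inr x)) mu nu.

Definition cluster_vertices (C : clustered_graph) (mu : cluster C) :
    {set vertex C} :=
  [set v | descendant (parent (inl v)) mu]%SET.

Definition c_connected (C : clustered_graph) : Prop :=
  forall (mu : cluster C) (u v : vertex C),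
    u \in cluster_vertices mu -> v \in cluster_vertices mu ->
    connect [rel x y | [&& x \in cluster_vertices mu,
                           y \in cluster_vertices mu & adj x y]] u v.

Definition flat (C : clustered_graph) : Prop :=
  forall mu nu : cluster C, mu != root C -> descendant nu mu -> nu = mu.

Local Open Scope ring_scope.
Local Open Scope classical_set_scope.
Local Open Scope card_scope.

Definition plane (R : realType) := (R * R)%type.

Section Topology.
Variable R : realType.
Local Notation plane := (plane R).

Definition frontier (A : set plane) : set plane := closure A `\` interior A.

Definition simple_arc (f : R -> plane) : Prop :=
  {within `[0, 1], continuous f} /\ {in `[0, 1] &, injective f}.

Definition simple_closed_curve (J : set plane) : Prop :=
  exists f : R -> plane,
    [/\ {within `[0, 1], continuous f}, f 0 = f 1,
        {in `[0, 1[ &, injective f} & J = f @` `[0, 1]].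

(* The closure of a bounded domain, with a Jordan curve as boundary. *)
Definition simple_closed_region (A : set plane) : Prop :=
  [/\ compact A, A = closure (interior A), connected (interior A)
    & simple_closed_curve (frontier A)].

(* A and B alternate around p: some neighbourhood of p (the range of the open
   embedding g) is homeomorphic to the plane in such a way that A becomes the
   first coordinate axis, B the second one, and p the origin.  In particular p
   is an isolated point of A `&` B. *)
Definition alternate (A B : set plane) (p : plane) : Prop :=
  exists g : plane -> plane,
    [/\ continuous g, injective g,
        (forall O : set plane, open O -> open (g @` O)), g (0, 0) = p
      & forall z : plane, (A (g z) <-> z.2 = 0) /\ (B (g z) <-> z.1 = 0)].

Definition components (A : set plane) : set (set plane) :=
  [set connected_component A x | x in A].

Record graph_drawing (G : sgraph) := GraphDrawing {
  point_of : vertex G -> plane;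
  arc_of : edge G -> R -> plane }.

Definition open_curve (G : sgraph) (D : graph_drawing G) (e : edge G) :
    set plane :=
  arc_of D e @` `]0, 1[.

Definition is_graph_drawing (G : sgraph) (D : graph_drawing G) : Prop :=
  [/\ injective (point_of D),
      (forall e : edge G, simple_arc (arc_of D e)),
      (forall e : edge G, exists u v : vertex G,
         [/\ val e = [set u; v]%SET, arc_of D e 0 = point_of D u
           & arc_of D e 1 = point_of D v])
    & (forall (e : edge G) (v : vertex G), ~ open_curve D e (point_of D v))].

(* Edges are drawn as open curves, so that edges sharing an endpoint do not
   meet at that endpoint. *)
Definition no_edge_edge_crossing (G : sgraph) (D : graph_drawing G) : Prop :=
  forall e e' : edge G, e != e' -> open_curve D e `&` open_curve D e' = set0.

Definition planar (G : sgraph) : Prop :=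
  exists2 D : graph_drawing G, is_graph_drawing D & no_edge_edge_crossing D.

Record drawing (C : clustered_graph) := Drawing {
  drawing_graph :> graph_drawing C;
  region : cluster C -> set plane }.

(* The curves of a drawing are its edges and the boundaries of its regions. *)
Definition curve (C : clustered_graph) (D : drawing C)
    (c : edge C + cluster C) : set plane :=
  match c with
  | inl e => open_curve D e
  | inr mu => frontier (region D mu)
  end.

Record is_drawing (C : clustered_graph) (D : drawing C) : Prop := IsDrawing {
  drawing_graphP : is_graph_drawing D;
  drawing_regionP : forall mu, simple_closed_region (region D mu);
  drawing_vertices : forall mu v,
    region D mu (point_of D v) <-> v \in cluster_vertices mu;
  drawing_vertices_off_frontier : forall mu v,
    ~ frontier (region D mu) (point_of D v);
  drawing_nested : forall mu nu,
    descendant mu nu -> region D mu `<=` region D nu;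
  drawing_no_three : forall c1 c2 c3 : edge C + cluster C,
    c1 != c2 -> c1 != c3 -> c2 != c3 ->
    curve D c1 `&` curve D c2 `&` curve D c3 = set0;
  drawing_alternate : forall (c1 c2 : edge C + cluster C) (p : plane),
    c1 != c2 -> curve D c1 p -> curve D c2 p ->
    alternate (curve D c1) (curve D c2) p }.

(* [k e mu] is the number of times e crosses the boundary of the region of mu
   (in a drawing, every common point is a crossing). *)
Definition edge_region_crossings (C : clustered_graph) (D : drawing C)
    (beta : nat) : Prop :=
  exists k : edge C -> cluster C -> nat,
    (forall e mu, open_curve D e `&` frontier (region D mu) #= `I_(k e mu)) /\
    beta = (\sum_(e : edge C) \sum_(mu : cluster C) (k e mu)./2)%N.

Definition region_region_crossings (C : clustered_graph) (D : drawing C)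
    (mu nu : cluster C) (n : nat) : Prop :=
  components (region D mu `\` region D nu) #= `I_n.+1.

Definition zero_beta_zero_drawing (C : clustered_graph) (D : drawing C)
    (beta : nat) : Prop :=
  [/\ is_drawing D,
      no_edge_edge_crossing D,
      edge_region_crossings D beta
    & forall mu nu : cluster C, ~~ descendant mu nu -> ~~ descendant nu mu ->
        region_region_crossings D mu nu 0].

End Topology.

(* Main.v *)
Require Import Defs.
From HB Require Import structures.
From mathcomp Require Import all_boot all_order all_algebra.
From mathcomp Require Import all_classical all_reals all_analysis.
From mathcomp Require Import zify ring lra.

(**
The graph consists of copies of K5 minus an edge (a triangular bipyramid) glued
along one common apex u; the equatorial triangle a_0 a_1 a_2 of each copy is a
cluster and v denotes the other apex.  In every drawing each copy pays at least
one edge-region crossing.  Otherwise the boundary J of the cluster region meets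
each edge u a_i in exactly one point p_i, each edge v a_i in exactly one point
q_i, and no edge a_i a_j.  If for every j one of the two arcs of J between p_j
and q_j avoids the other p_i, then u, v and a_0 are joined to p_0, p_1, p_2 by
a K_{3,3}.  Otherwise p_j and q_j separate p_i from p_k on J, and
p_j, q_j, a_i | p_i, p_k, a_j are the two sides of a K_{3,3} formed by J and
the edges inside it.

The Jordan curve theorem is not needed: the only topological input is that
K_{3,3} cannot be drawn with disjoint images of any two nonadjacent edges (adjacent
edges may meet).  This is a mod 2 winding number argument: for nonadjacent edges
e = uv and f = xy the map (s, t) |-> e(s) - f(t) does not vanish on the square,
so its winding parity along the boundary is even; summing this over the 18
pairs of nonadjacent edges, every winding term occurs twice and what is left
is odd.
*)

Set Implicit Arguments.
Unset Strict Implicit.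
Unset Printing Implicit Defensive.
Import Order.TTheory GRing.Theory Num.Theory.
Import numFieldNormedType.Exports.

(** * Parity counts on grids and on K_{3,3} *)

Lemma grid_boundary_parity (N : nat) (H V : nat -> nat -> bool) :
  (forall i j, i < N -> j < N ->
     H i j (+) V i.+1 j (+) H i j.+1 (+) V i j = false) ->
  \big[addb/false]_(i < N) H i 0 (+) \big[addb/false]_(i < N) H i N (+)
  \big[addb/false]_(j < N) V 0 j (+) \big[addb/false]_(j < N) V N j = false.
Proof.
move=> cell.
(* Summing the cells of a row cancels the interior vertical sides in pairs; stacking the rows then
   cancels the interior horizontal sides. *)
have row j n : j < N -> n <= N -> \big[addb/false]_(i < n) H i j (+)
    \big[addb/false]_(i < n) H i j.+1 = V 0 j (+) V n j.
  move=> jN; elim: n => [|n IH] nN; first by rewrite !big_ord0 !addbb.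
  rewrite !big_ord_recr /= addbACA IH ?(ltnW nN) //.
  by move: (cell n j nN jN); case: (H n j) (V n.+1 j) (H n j.+1) (V n j) (V 0 j) => [] [] [] [] [].
have col n : n <= N -> \big[addb/false]_(i < N) H i 0 (+)
    \big[addb/false]_(i < N) H i n =
    \big[addb/false]_(j < n) V 0 j (+) \big[addb/false]_(j < n) V N j.
  elim: n => [|n IH] nN; first by rewrite !big_ord0 !addbb.
  rewrite !big_ord_recr /= addbACA -row // -IH ?(ltnW nN) //.
  by move: (bigop _ _ _) (bigop _ _ _) (bigop _ _ _) => [] [] [].
by rewrite col // -addbA addbb.
Qed.

(* [mL i j k] and [mR i j l] are the winding parities of the edge P_i Q_j around
   P_k and Q_l; [hP], [hQ] and [h] tell which of two vertices is higher. *)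
Lemma K33_parity (mL mR : nat -> nat -> nat -> bool)
    (hP hQ h : nat -> nat -> bool) :
  (forall i k, i < k < 3 -> hP k i = ~~ hP i k) ->
  (forall j l, j < l < 3 -> hQ l j = ~~ hQ j l) ->
  ~ (forall i j k l, i < k < 3 -> j < 3 -> l < 3 -> j != l ->
     mL i j k (+) mR i j l (+) mL k l i (+) mR k l j (+)
     hP k i (+) h l i (+) ~~ h j k (+) hQ l j = false).
Proof.
move=> aP aQ E.
have even_double n : odd n = false -> exists t, n = t * 2.
  by move=> n_even; exists n./2; rewrite muln2 -[LHS]odd_double_half n_even.
(* The parities are recast as evenness of sums in [nat], so that linear arithmetic can collect
   multiplicities. *)
have sum_even (i k : nat) : i < k < 3 -> exists t : nat,
    \sum_(j < 3) \sum_(l < 3 | j != l :> nat) (mL i j k + mR i j l +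
      mL k l i + mR k l j + hP k i + h l i + ~~ h j k + hQ l j) = t * 2.
  move=> ik; apply: even_double.
  rewrite (big_morph odd oddD (erefl _)); apply: big1 => j _.
  rewrite (big_morph odd oddD (erefl _)); apply: big1 => l jl.
  by rewrite !oddD !oddb E //; lia.
have [t1 e1] := sum_even 0 1 isT.
have [t2 e2] := sum_even 0 2 isT.
have [t3 e3] := sum_even 1 2 isT.
move: e1 e2 e3.
rewrite !big_ord_recl !big_ord0 /=.
do ![rewrite ?big_mkcond /= ?big_ord_recl ?big_ord0 /=].
rewrite /bump /= !addn0 !add0n !add1n.
rewrite (aQ 0 1) // (aQ 0 2) // (aQ 1 2) //.
rewrite (aP 0 1) // (aP 0 2) // (aP 1 2) // => e1 e2 e3.
(* In the total every term outside [hQ] has even multiplicity, whereas [hQ j l] and [hQ l j] add up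
   to 1 for each of three pairs j < l and each of three pairs i < k: nine in all, an odd number. *)
have := f_equal2 addn (f_equal2 addn e1 e2) e3; clear.
have addn_negb (b : bool) : ~~ b + b = 1 by case: b.
repeat match goal with |- context [nat_of_bool (~~ ?b)] =>
  have := addn_negb b; move: (nat_of_bool (~~ b)) => ? end.
clear; repeat match goal with |- context [nat_of_bool ?b] =>
  move: (nat_of_bool b) => ? end.
lia.
Qed.

Local Open Scope ring_scope.
Local Open Scope classical_set_scope.

(** * Winding numbers mod 2 and the nonplanarity of K_{3,3} *)

Section Winding.
Variable R : realType.
Local Notation plane := (plane R).
Implicit Types w : plane.

(* Ties on the horizontal axis are broken so that [upper (- w) = ~~ upper w]. *)
Definition upper w : bool := (0 < w.2) || (w.2 == 0) && (0 < w.1).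

Lemma upperN w : w != 0 -> upper (- w) = ~~ upper w.
Proof.
case: w => x y; rewrite /upper /= !oppr_gt0 oppr_eq0 => w0.
have [xy|xy|xy] := ltgtP y 0 => //=.
by have [x0|x0|x0] := ltgtP x 0 => //=; rewrite xy x0 eqxx in w0.
Qed.

(* For nearby [w], [w'], this tells whether the step from [w] to [w'] crosses
   the positive horizontal half-axis. *)
Definition crossing w w' : bool := (upper w (+) upper w') && (0 < w.1).

(** The four open half-planes cover the plane without the origin, and no closed walk inside one of
    them winds around the origin. *)
Definition one_sided (A : set plane) : Prop :=
  [\/ forall w, A w -> 0 < w.1, forall w, A w -> w.1 < 0,
      forall w, A w -> 0 < w.2 | forall w, A w -> w.2 < 0].

(** On the right each [upper] occurs twice around the cell; on the left nothing is counted; above or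
    below the axis [upper] is constant. *)
Lemma crossing_cell (A : set plane) w00 w10 w01 w11 : one_sided A ->
  A w00 -> A w10 -> A w01 -> A w11 ->
  crossing w00 w10 (+) crossing w10 w11 (+) crossing w01 w11 (+)
    crossing w00 w01 = false.
Proof.
rewrite /crossing => -[] sA a00 a10 a01 a11.
- rewrite !sA // !andbT.
  by case: (upper w00) (upper w10) (upper w01) (upper w11) => [] [] [] [].
- by rewrite ![0 < _]lt_gtF ?sA ?andbF.
- by rewrite /upper !sA.
- by rewrite /upper !lt_eqF ?[0 < _.2]lt_gtF ?sA.
Qed.

Lemma one_sided_neq0 (A : set plane) w : one_sided A -> A w -> w != 0.
Proof.
by move=> sA Aw; apply/eqP => w0; case: sA => /(_ _ Aw); rewrite w0 /= ltxx.
Qed.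

(** Negation exchanges the two horizontal half-axes, and [upper w (+) upper w'] tells whether the
    step crosses the axis at all. *)
Lemma crossingN (A : set plane) w w' : one_sided A -> A w -> A w' ->
  crossing (- w) (- w') = crossing w w' (+) upper w (+) upper w'.
Proof.
move=> sA aw aw'.
rewrite /crossing !upperN ?(one_sided_neq0 sA) //= oppr_gt0.
case: sA => sA.
- by rewrite [w.1 < 0]lt_gtF ?sA // andbF andbT -addbA addbb.
- by rewrite [0 < w.1]lt_gtF ?sA // andbF andbT addbN addNb negbK.
- by rewrite /upper !sA.
- by rewrite /upper !lt_eqF ?[0 < _.2]lt_gtF ?sA.
Qed.

Lemma one_sided_nbhs (w : plane) : w != 0 ->
  exists2 A : set plane, nbhs w A & one_sided A.
Proof.
case: w => x y w0.
have nb1 (B : set R) : nbhs x B -> nbhs ((x, y) : plane) [set z | B z.1].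
  by move=> Bx; apply: cvg_fst.
have nb2 (B : set R) : nbhs y B -> nbhs ((x, y) : plane) [set z | B z.2].
  by move=> Bx; apply: cvg_snd.
have [x0|x0|x0] := ltgtP x 0.
- by exists [set z | z.1 < 0]; [apply: (nb1 [set r | r < 0]); apply: lt_nbhsl|apply: Or42].
- by exists [set z | 0 < z.1]; [apply: (nb1 [set r | 0 < r]); apply: lt_nbhsr|apply: Or41].
have [y0|y0|y0] := ltgtP y 0.
- by exists [set z | z.2 < 0]; [apply: (nb2 [set r | r < 0]); apply: lt_nbhsl|apply: Or44].
- by exists [set z | 0 < z.2]; [apply: (nb2 [set r | 0 < r]); apply: lt_nbhsr|apply: Or43].
by rewrite x0 y0 eqxx in w0.
Qed.

(** A Lebesgue number argument: by compactness of the square one mesh size serves all its points. *)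
Lemma one_sided_cells (W : R * R -> plane) : continuous W ->
  (forall s t, 0 <= s <= 1 -> 0 <= t <= 1 -> W (s, t) != 0) ->
  \forall n \near \oo, forall s t, 0 <= s <= 1 -> 0 <= t <= 1 ->
    exists2 A, one_sided A & forall s' t', `|s' - s| <= n.+1%:R^-1 ->
      `|t' - t| <= n.+1%:R^-1 -> A (W (s', t')).
Proof.
move=> cW W0.
have /compact_near_coveringP cpt :=
  compact_setX (@segment_compact R 0 1) (@segment_compact R 0 1).
pose P (n : nat) (z : R * R) := exists2 A, one_sided A &
   forall s' t', `|s' - z.1| <= n.+1%:R^-1 -> `|t' - z.2| <= n.+1%:R^-1 ->
     A (W (s', t')).
have H : forall x : R * R, (`[0%R, 1%R] `*` `[0%R, 1%R])%classic x ->
       \forall x' \near x & i \near \oo, P i x'.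
  move=> [s t] [/= s01 t01]; rewrite !in_itv /= in s01 t01.
  have [A nA sA] := one_sided_nbhs (W0 _ _ s01 t01).
  have /nbhs_ballP[e /= e0 eA] := cW _ _ nA.
  (* Half of the radius is spent on moving the centre, the other half on the mesh. *)
  have e20 : 0 < e / 2 by rewrite divr_gt0.
  exists (ball (s, t) (e / 2), [set n : nat | n.+1%:R^-1 < e / 2]).
    by split=> /=; [exact: nbhsx_ballx|apply: (near_infty_natSinv_lt (PosNum e20))].
  move=> [[s1 t1] n] [/= [bs bt] ne]; exists A => // s' t' /= s's1 t't1.
  apply: eA; split; rewrite /ball /= in bs bt *.
    by rewrite (splitr e) (le_lt_trans (ler_distD s1 _ _))// ltrD // distrC; apply: le_lt_trans ne.
  by rewrite (splitr e) (le_lt_trans (ler_distD t1 _ _))// ltrD // distrC; apply: le_lt_trans ne.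
have [N _ PN] := cpt nat \oo P _ H; exists N => // n Nn s t s01 t01.
by apply: (PN n Nn (s, t)); split; rewrite /= in_itv.
Qed.

(* The parity of the winding of f around x, read off N sample steps. *)
Definition winding (N : nat) (f : R -> plane) (x : plane) : bool :=
  \big[addb/false]_(i < N) crossing (f (i%:R / N%:R) - x) (f (i.+1%:R / N%:R) - x).

Lemma big_addb_telescope (N : nat) (u : nat -> bool) :
  \big[addb/false]_(i < N) (u i (+) u i.+1) = u 0%N (+) u N.
Proof.
elim: N => [|N IH]; first by rewrite big_ord0 addbb.
by rewrite big_ord_recr /= IH -addbA addKb.
Qed.

(** The grid of values f(s) - g(t) has even boundary parity. Two opposite sides give the windings of
    f around the ends of g; the other two give those of g around the ends of f, up to [upper] terms
    at the corners. *)
Lemma winding_square (n : nat) (f g : R -> plane) :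
  (forall s t, 0 <= s <= 1 -> 0 <= t <= 1 ->
    exists2 A, one_sided A & forall s' t', `|s' - s| <= n.+1%:R^-1 ->
      `|t' - t| <= n.+1%:R^-1 -> A (f s' - g t')) ->
  winding n.+1 f (g 0) (+) winding n.+1 f (g 1) (+)
  winding n.+1 g (f 0) (+) winding n.+1 g (f 1) (+)
  upper (g 0 - f 0) (+) upper (g 1 - f 0) (+)
  upper (g 0 - f 1) (+) upper (g 1 - f 1) = false.
Proof.
move=> cells; set N := n.+1.
pose p (i : nat) : R := i%:R / N%:R.
have p0 : p 0%N = 0 by rewrite /p mul0r.
have pN : p N = 1 by rewrite /p divff // pnatr_eq0.
have p01 i : (i < N)%N -> 0 <= p i <= 1.
  move=> iN; rewrite /p divr_ge0 ?ler0n //= ler_pdivrMr ?ltr0n // mul1r ler_nat.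
  exact: ltnW.
have pS i : `|p i.+1 - p i| <= N%:R^-1.
  by rewrite /p -mulrBl -natrB // subSnn mul1r ger0_norm // invr_ge0.
have pp i : `|p i - p i| <= N%:R^-1 by rewrite subrr normr0 invr_ge0.
pose H i j := crossing (f (p i) - g (p j)) (f (p i.+1) - g (p j)).
pose V i j := crossing (f (p i) - g (p j)) (f (p i) - g (p j.+1)).
have := @grid_boundary_parity N H V.
have cellE i j : (i < N)%N -> (j < N)%N ->
     H i j (+) V i.+1 j (+) H i j.+1 (+) V i j = false.
  move=> iN jN; have [A sA aA] := cells _ _ (p01 i iN) (p01 j jN).
  by apply: (crossing_cell sA); apply: aA.
move=> /(_ cellE).
(* These sides record f - g instead of g - f; the corrections from [crossingN] telescope to the two
   corners. *)
have VE i : (forall j, (j < N)%N -> exists2 A, one_sided A &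
      A (f (p i) - g (p j)) /\ A (f (p i) - g (p j.+1))) ->
    \big[addb/false]_(j < N) V i j =
    winding N g (f (p i)) (+) (upper (g 0 - f (p i)) (+) upper (g 1 - f (p i))).
  move=> one_sidedV.
  have := big_addb_telescope N (fun j => upper (g (p j) - f (p i))).
  rewrite p0 pN => <-; rewrite /winding -big_split; apply: eq_bigr => j _ /=.
  have [A sA [Aj AjS]] := one_sidedV j (ltn_ord j).
  rewrite -/(p j) -/(p j.+1) -[g (p j) - _]opprB -[g (p j.+1) - _]opprB.
  rewrite (crossingN sA) // !upperN ?(one_sided_neq0 sA) // /V.
  by case: (crossing _ _) (upper _) (upper _) => [] [] [].
rewrite (VE 0%N) ?(VE N) ?p0 ?pN.
- rewrite /H p0 pN -/(winding N f (g 0)) -/(winding N f (g 1)).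
  move: (winding N f (g 0)) (winding N f (g 1)) (winding N g (f 0)).
  move: (winding N g (f 1)) (upper (g 0 - f 0)) (upper (g 1 - f 0)).
  by move: (upper (g 0 - f 1)) (upper (g 1 - f 1)) => [] [] [] [] [] [] [] [].
- move=> j jN; have [A sA aA] := cells _ _ (p01 n (ltnSn n)) (p01 j jN).
  by exists A => //; split; apply: aA => //; have := pS n; rewrite -/N pN.
- move=> j jN; have [A sA aA] := cells _ _ (p01 0%N (ltn0Sn n)) (p01 j jN).
  by exists A => //; split; apply: aA => //; rewrite p0 subrr normr0 invr_ge0.
Qed.

Theorem K33_nonplanar (P Q : 'I_3 -> plane) (f : 'I_3 -> 'I_3 -> R -> plane) :
  (forall i j, continuous (f i j)) ->
  (forall i j, f i j 0 = P i) -> (forall i j, f i j 1 = Q j) ->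
  ~ (forall i j k l s t, i != k -> j != l -> 0 <= s <= 1 -> 0 <= t <= 1 ->
      f i j s <> f k l t).
Proof.
move=> cf f0 f1 disj.
pose W (e : 'I_3 * 'I_3) (e' : 'I_3 * 'I_3) (z : R * R) : plane :=
  f e.1 e.2 z.1 - f e'.1 e'.2 z.2.
have cW e e' : continuous (W e e').
  move=> z.
  have cf1 : {for z, continuous (f e.1 e.2 \o @fst R R)}.
    by apply: continuous_comp; [exact: cvg_fst|exact: cf].
  have cf2 : {for z, continuous (f e'.1 e'.2 \o @snd R R)}.
    by apply: continuous_comp; [exact: cvg_snd|exact: cf].
  exact: cvgB cf1 cf2.
(* One sample count is chosen for all pairs of edges, so that a winding term is the same boolean in
   each relation where it occurs. *)
have : \forall n \near \oo, forall ee : ('I_3 * 'I_3) * ('I_3 * 'I_3),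
    ee.1.1 != ee.2.1 -> ee.1.2 != ee.2.2 ->
    forall s t, 0 <= s <= 1 -> 0 <= t <= 1 ->
    exists2 A, one_sided A & forall s' t', `|s' - s| <= n.+1%:R^-1 ->
      `|t' - t| <= n.+1%:R^-1 -> A (W ee.1 ee.2 (s', t')).
  apply: filter_forall => -[e e'] /=.
  have [d1|d1] := boolP (e.1 != e'.1); last by apply: nearW.
  have [d2|d2] := boolP (e.2 != e'.2); last by apply: nearW.
  have := one_sided_cells (cW e e').
  case=> [s t s01 t01|n nN cells].
    by rewrite /W subr_eq0; apply/eqP; apply: disj.
  by exists n => // m nm _ _; apply: cells.
case=> n _ /(_ n (leqnn n)) cells.
pose o (i : nat) : 'I_3 := inord i.
have oE i k : (i < 3)%N -> (k < 3)%N -> i != k -> o i != o k.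
  by move=> i3 k3; rewrite -val_eqE /= !inordK.
have o_lt i k : (i < k < 3)%N -> o i != o k.
  by case/andP => ik k3; apply: oE => //; lia.
have upperC x y : x != y -> upper (x - y) = ~~ upper (y - x).
  by move=> xy; rewrite -opprB upperN // subr_eq0 eq_sym.
have I01 : 0 <= (0 : R) <= 1 by rewrite lexx ler01.
have I11 : 0 <= (1 : R) <= 1 by rewrite lexx ler01.
have PP i k : i != k -> P i != P k.
  move=> ik; apply/eqP => PP; apply: (disj i ord0 k ord_max 0 0) => //.
  by rewrite !f0.
have QQ j l : j != l -> Q j != Q l.
  move=> jl; apply/eqP => QQ; apply: (disj ord0 j ord_max l 1 1) => //.
  by rewrite !f1.
have PQ i j : P i != Q j.
  have [i' ii'] : exists i', i != i'.
    by have [->|i0] := eqVneq i ord0; [exists ord_max|exists ord0].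
  have [j' jj'] : exists j', j' != j.
    have [->|j0] := eqVneq j ord0; [by exists ord_max|].
    by exists ord0; rewrite eq_sym.
  apply/eqP => PQ; apply: (disj i j' i' j 0 1) => //.
  by rewrite f0 f1.
pose m i j x := winding n.+1 (f (o i) (o j)) x.
apply: (@K33_parity (fun i j k => m i j (P (o k))) (fun i j l => m i j (Q (o l)))
  (fun i k => upper (P (o i) - P (o k))) (fun j l => upper (Q (o j) - Q (o l)))
  (fun j i => upper (Q (o j) - P (o i)))) => [i k ik|j l jl|i j k l ik j3 l3 jl].
- by rewrite upperC // PP // eq_sym o_lt.
- by rewrite upperC // QQ // eq_sym o_lt.
have := @winding_square n (f (o i) (o j)) (f (o k) (o l))
  (cells ((o i, o j), (o k, o l)) (o_lt _ _ ik) (oE _ _ j3 l3 jl)).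
by rewrite /= !f0 !f1 -(upperC (P (o k))).
Qed.
End Winding.

(** * Continuous paths inside a set *)

Section Paths.
Variable R : realType.
Local Notation plane := (plane R).
Implicit Types (S : set plane) (p q r : plane).

(** The retraction of the line onto [0, 1]; composing with it makes a curve continuous on [0, 1]
    continuous everywhere. *)
Definition clamp (t : R) : R := Num.max 0 (Num.min 1 t).

Lemma clamp_itv (t : R) : 0 <= clamp t <= 1.
Proof. by rewrite /clamp le_max lexx ge_max ler01 ge_min lexx. Qed.

Lemma clamp_id (t : R) : 0 <= t <= 1 -> clamp t = t.
Proof. by case/andP => t0 t1; rewrite /clamp min_r // max_r. Qed.

Lemma clamp_le0 (t : R) : t <= 0 -> clamp t = 0.
Proof. by move=> t0; rewrite /clamp max_l // ge_min t0 orbT. Qed.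

Lemma clamp_ge1 (t : R) : 1 <= t -> clamp t = 1.
Proof. by move=> t1; rewrite /clamp min_l // max_r. Qed.

Lemma clamp_continuous : continuous clamp.
Proof.
move=> t; apply: continuous_max; first exact: cvg_cst.
by apply: continuous_min; [exact: cvg_cst|exact: cvg_id].
Qed.

Lemma within_clamp_continuous (f : R -> plane) :
  {within `[0, 1], continuous f} -> continuous (f \o clamp).
Proof.
move=> /subspace_continuousP cf t.
apply: (cvg_comp clamp f _ (cf (clamp t) _)); last by rewrite /= in_itv /= clamp_itv.
move=> A /= wA.
have : \forall s \near t, `[0%R, 1%R]%classic (clamp s) -> A (clamp s).
  exact: clamp_continuous wA.
rewrite /nbhs /=; apply: filterS => s /=.
by apply; rewrite in_itv /= clamp_itv.
Qed.

Lemma continuous_reparam (T : topologicalType) (f : R -> T) (u : R -> R) :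
  continuous u -> continuous f -> continuous (fun t => f (u t)).
Proof. by move=> cu cf t; exact: continuous_comp (cu t) (cf (u t)). Qed.

(** Continuity on the whole line avoids subspace topologies, and self-intersections are allowed, so
    paths can be concatenated freely. *)
Definition path_in S p q : Prop :=
  exists f : R -> plane,
    [/\ continuous f, f 0 = p, f 1 = q & forall t, 0 <= t <= 1 -> S (f t)].

Lemma path_inW S S' p q : S `<=` S' -> path_in S p q -> path_in S' p q.
Proof. by move=> SS' [f [cf f0 f1 fS]]; exists f; split=> // t /fS/SS'. Qed.

Lemma path_in_sym S p q : path_in S p q -> path_in S q p.
Proof.
move=> [f [cf f0 f1 fS]]; exists (fun t => f (1 - t)); split.
- apply: continuous_reparam => // t.
  by apply: cvgB; [exact: cvg_cst|exact: cvg_id].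
- by rewrite subr0.
- by rewrite subrr.
- by move=> t t01; apply: fS; lra.
Qed.

Lemma path_in_trans S q p r : path_in S p q -> path_in S q r -> path_in S p r.
Proof.
move=> [f [cf f0 f1 fS]] [g [cg g0 g1 gS]].
have c2 : continuous (fun t : R => t + t) by move=> t; apply: cvgD; exact: cvg_id.
have c21 : continuous (fun t : R => t + t - 1).
  by move=> t; apply: cvgB; [exact: c2|exact: cvg_cst].
(* At every time one of the two summands rests at q, which the subtraction removes; continuity is
   then that of a sum. *)
exists (fun t => f (clamp (t + t)) + g (clamp (t + t - 1)) - q); split.
- have cf' := continuous_reparam c2 (continuous_reparam clamp_continuous cf).
  have cg' := continuous_reparam c21 (continuous_reparam clamp_continuous cg).
  by move=> t; apply: cvgB; [exact: cvgD (cf' t) (cg' t)|exact: cvg_cst].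
- by rewrite addr0 clamp_id ?clamp_le0 ?f0 ?g0 ?addrK //; lra.
- by rewrite clamp_ge1 ?addrK ?clamp_id ?f1 ?g1 ?[q + r]addrC ?addrK //; lra.
move=> t t01; have [th|/ltW th] := leP (t + t) 1.
  by rewrite [clamp (t + t - 1)]clamp_le0 ?g0 ?addrK; [rewrite clamp_id; [apply: fS|]|]; lra.
rewrite clamp_ge1 // f1 addrC addKr clamp_id; last by lra.
by apply: gS; lra.
Qed.

Lemma subpath (f : R -> plane) (s t : R) : {within `[0, 1], continuous f} ->
  0 <= s -> s <= t -> t <= 1 ->
  path_in [set z | exists2 x, s <= x <= t & f x = z] (f s) (f t).
Proof.
move=> /within_clamp_continuous cf s0 st t1.
exists (fun x => (f \o clamp) (s + x * (t - s))); split.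
- apply: (@continuous_reparam _ (f \o clamp) (fun x => s + x * (t - s))) => // x.
  apply: cvgD; first exact: cvg_cst.
  by apply: cvgMl; exact: cvg_id.
- by rewrite /= mul0r addr0 clamp_id //; lra.
- by rewrite /= mul1r addrC subrK clamp_id //; lra.
- move=> x x01; have sx : s <= s + x * (t - s) <= t by nra.
  by exists (s + x * (t - s)) => //=; rewrite clamp_id //; lra.
Qed.

Lemma subpath_in S (f : R -> plane) (s t : R) : {within `[0, 1], continuous f} ->
  0 <= s -> s <= t -> t <= 1 -> (forall x, s <= x <= t -> S (f x)) ->
  path_in S (f s) (f t).
Proof.
by move=> cf s0 st t1 fS; apply: path_inW (subpath cf s0 st t1) => _ [x /fS + <-].
Qed.

(** Off the frontier, closure and interior coincide, so the interior has a clopen trace on the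
    connected image of the path. *)
Lemma path_avoids_frontier (A : set plane) p q :
  path_in (~` frontier A) p q -> A p -> interior A q.
Proof.
move=> [f [cf <- <- fA]] Af0.
pose I := f @` `[0, 1].
have cI : connected I.
  apply: connected_continuous_connected; first exact: segment_connected.
  exact: continuous_subspaceT.
have frI z : I z -> closure A z -> interior A z.
  move=> [t]; rewrite /= in_itv /= => t01 <- clA; apply: contrapT => niA.
  by apply: (fA t t01).
have I0 : I (f 0) by exists 0 => //; rewrite /= in_itv /= lexx ler01.
have I1 : I (f 1) by exists 1 => //; rewrite /= in_itv /= lexx ler01.
suff IA : I `&` interior A = I by move: I1; rewrite -IA => -[].
apply: cI.
- by exists (f 0); split=> //; apply: frI => //; exact: subset_closure.
- by exists (interior A) => //; exact: open_interior.
- exists (closure A); first exact: closed_closure.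
  apply/seteqP; split=> z [Iz Az]; split=> //; last exact: frI.
  by apply: subset_closure; exact: interior_subset.
Qed.

Lemma K33_no_paths (P Q : 'I_3 -> plane) (S : 'I_3 -> 'I_3 -> set plane) :
  (forall i j, path_in (S i j) (P i) (Q j)) ->
  ~ (forall i j k l z, i != k -> j != l -> S i j z -> S k l z -> False).
Proof.
move=> pS disj.
have /choice[f fP] : forall e : 'I_3 * 'I_3, exists f : R -> plane,
    [/\ continuous f, f 0 = P e.1, f 1 = Q e.2
      & forall t, 0 <= t <= 1 -> S e.1 e.2 (f t)] by move=> [i j]; exact: pS.
apply: (@K33_nonplanar R P Q (fun i j => f (i, j))) => [i j|i j|i j|].
- by case: (fP (i, j)).
- by case: (fP (i, j)).
- by case: (fP (i, j)).
move=> i j k l s t ik jl s01 t01 st; apply: (disj i j k l (f (i, j) s)) => //.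
  by case: (fP (i, j)) => _ _ _; apply.
by rewrite st; case: (fP (k, l)) => _ _ _; apply.
Qed.

End Paths.

(** * Chords of a closed curve and the bipyramid obstruction *)

Section JordanCurve.
Variable R : realType.
Local Notation plane := (plane R).

Definition avoids (A B : set plane) : Prop := forall z, A z -> B z -> False.

Lemma avoids_sym A B : avoids A B -> avoids B A.
Proof. by move=> AB z Bz Az; exact: AB Az Bz. Qed.

Variable f : R -> plane.
Hypothesis f_cont : {within `[0, 1], continuous f}.
Hypothesis f_loop : f 0 = f 1.
Hypothesis f_inj : {in `[0, 1[ &, injective f}.
Let J := f @` `[0, 1].

Definition arc (s t : R) : set plane :=
  [set z | exists2 x, s <= x <= t & f x = z].

(** The complementary arc of the loop, through the base point f 0 = f 1. *)
Definition coarc (s t : R) : set plane := arc 0 s `|` arc t 1.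

Lemma loop_inj (x y : R) : 0 <= x <= 1 -> 0 <= y < 1 -> f x = f y ->
  x = y \/ x = 1 /\ y = 0.
Proof.
move=> /andP[x0 x1] y01 fxy.
have [x1'|x1'] := ltP x 1.
  by left; apply: f_inj => //; rewrite inE /= in_itv /= ?x0.
have x_eq : x = 1 by apply/le_anti; rewrite x1.
right; split=> //; apply: f_inj; rewrite ?inE /= ?in_itv /= ?lexx ?ltr01 //.
by rewrite -fxy x_eq f_loop.
Qed.

Lemma path_arc (s t : R) : 0 <= s -> s <= t -> t <= 1 ->
  path_in (arc s t) (f s) (f t).
Proof. exact: subpath. Qed.

Lemma path_coarc (s t : R) : 0 <= s -> s <= t -> t <= 1 ->
  path_in (coarc s t) (f s) (f t).
Proof.
move=> s0 st t1; apply: (@path_in_trans _ _ (f 0)).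
  apply: (path_inW (@subsetUl _ _ _)); apply: path_in_sym.
  by apply: path_arc => //; lra.
apply: (path_inW (@subsetUr _ _ _)); rewrite f_loop; apply: path_in_sym.
by apply: path_arc => //; lra.
Qed.

Lemma arc_sub (s t : R) : 0 <= s -> t <= 1 -> arc s t `<=` J.
Proof. by move=> s0 t1 z [x xst <-]; exists x => //=; rewrite in_itv /=; lra. Qed.

Lemma coarc_sub (s t : R) : s <= 1 -> 0 <= t -> coarc s t `<=` J.
Proof. by move=> s1 t0 z [] /arc_sub; apply; lra. Qed.

Lemma arcN (s t x : R) : 0 <= s -> t < 1 -> 0 <= x < 1 ->
  ~ (s <= x <= t) -> ~ arc s t (f x).
Proof. by move=> s0 t1 x01 xst [y yst /loop_inj[]]; [lra|lra|move=> yx; apply: xst; lra|lra]. Qed.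

Lemma coarcN (s t x : R) : 0 <= s -> t <= 1 -> s < x < t -> ~ coarc s t (f x).
Proof.
by move=> s0 t1 x01 [] [y yst /loop_inj[]]; lra.
Qed.

Lemma avoids_arc (s t s' t' : R) : 0 <= s -> t < s' -> t' < 1 ->
  avoids (arc s t) (arc s' t').
Proof.
move=> s0 tt t1 z [y yst yz] [x xst xz].
have : arc s t (f x) by rewrite xz; exists y.
by apply: arcN; try (move=> ?); lra.
Qed.

Lemma avoids_coarc (s t s' t' : R) : 0 <= s -> s < s' -> t' < t -> t <= 1 ->
  avoids (coarc s t) (arc s' t').
Proof. by move=> s0 ss tt t1 z sz [x xst xz]; move: sz; rewrite -xz; apply: coarcN; lra. Qed.

(** Two disjoint chords through a and b with interlaced ends, joined by T, form a K_{3,3} with sides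
    f t1, f t3, b and f t2, f t4, a. Its edges are four arcs of J, four half-chords and T; the edges
    not adjacent to T are exactly the arcs. *)
Lemma crossing_chords (t1 t2 t3 t4 : R) (a b : plane)
    (S1 S2 S3 S4 T : set plane) :
  0 <= t1 -> t1 < t2 -> t2 < t3 -> t3 < t4 -> t4 < 1 ->
  path_in S1 a (f t1) -> path_in S3 a (f t3) ->
  path_in S2 b (f t2) -> path_in S4 b (f t4) -> path_in T a b ->
  (forall z, S1 z -> J z -> z = f t1) -> (forall z, S2 z -> J z -> z = f t2) ->
  (forall z, S3 z -> J z -> z = f t3) -> (forall z, S4 z -> J z -> z = f t4) ->
  avoids T J ->
  avoids S1 S2 -> avoids S1 S4 -> avoids S3 S2 -> avoids S3 S4 -> False.
Proof.
move=> h1 h12 h23 h34 h4 p1 p3 p2 p4 pT J1 J2 J3 J4 JT d12 d14 d32 d34.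
have SJ S t K : (forall z, S z -> J z -> z = f t) -> K `<=` J -> ~ K (f t) ->
    avoids S K.
  by move=> SJ KJ Kt z Sz Kz; apply: Kt; rewrite -(SJ z) //; exact: KJ.
have TK K : K `<=` J -> avoids T K by move=> KJ z Tz /KJ; exact: JT.
pose M (i j : 'I_3) := nth set0 (nth [::] [::
  [:: arc t1 t2; coarc t1 t4; S1]; [:: arc t2 t3; arc t3 t4; S3]; [:: S2; S4; T]] i) j.
apply: (@K33_no_paths R (fun i => nth 0 [:: f t1; f t3; b] i)
   (fun j => nth 0 [:: f t2; f t4; a] j) M).
  move=> [[|[|[|//]]] ?] [[|[|[|//]]] ?] //; rewrite /M /=.
  - by apply: path_arc; lra.
  - by apply: path_coarc; lra.
  - exact: path_in_sym.
  - by apply: path_in_sym; apply: path_arc; lra.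
  - by apply: path_arc; lra.
  - exact: path_in_sym.
  - exact: path_in_sym.
have sub12 : arc t1 t2 `<=` J by apply: arc_sub; lra.
have sub23 : arc t2 t3 `<=` J by apply: arc_sub; lra.
have sub34 : arc t3 t4 `<=` J by apply: arc_sub; lra.
have sub41 : coarc t1 t4 `<=` J by apply: coarc_sub; lra.
have MM (i j k l : 'I_3) : (i < k)%N -> j != l -> avoids (M i j) (M k l).
  case: i j k l => [[|[|[|//]]] ?] [[|[|[|//]]] ?] [[|[|[|//]]] ?] [[|[|[|//]]] ?] // _ _;
  rewrite /M /=.
  - by apply: avoids_arc; lra.
  - by apply: avoids_sym; apply: (SJ _ _ _ J3) => //; apply: arcN; try (move=> ?); lra.
  - by apply: avoids_sym; apply: (SJ _ _ _ J4) => //; apply: arcN; try (move=> ?); lra.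
  - by apply: avoids_sym; exact: TK.
  - by apply: avoids_coarc; lra.
  - by apply: avoids_sym; apply: (SJ _ _ _ J3) => //; apply: coarcN; lra.
  - by apply: avoids_sym; apply: (SJ _ _ _ J2) => //; apply: coarcN; lra.
  - by apply: avoids_sym; exact: TK.
  - by apply: (SJ _ _ _ J1) => //; apply: arcN; try (move=> ?); lra.
  - by apply: (SJ _ _ _ J1) => //; apply: arcN; try (move=> ?); lra.
  - by apply: avoids_sym; apply: (SJ _ _ _ J4) => //; apply: arcN; try (move=> ?); lra.
  - by apply: avoids_sym; exact: TK.
  - by apply: avoids_sym; apply: (SJ _ _ _ J2) => //; apply: arcN; try (move=> ?); lra.
  - by apply: avoids_sym; exact: TK.
move=> i j k l z ik jl zi zk; move: ik; rewrite -val_eqE /= neq_ltn => /orP[] ik.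
  exact: (MM i j k l ik jl z).
by apply: (MM k l i j ik _ z) => //; rewrite eq_sym.
Qed.

(* The edge u a_i is split by its crossing p_i with J into U_i and A_i, the edge
   v a_i by its crossing q_i into V_i and B_i, and T_ij is the edge a_i a_j. *)
Lemma no_bipyramid_drawing (u v : plane) (a p q : 'I_3 -> plane)
    (U A V B : 'I_3 -> set plane) (T : 'I_3 -> 'I_3 -> set plane) :
  (forall i, J (p i)) -> (forall i, J (q i)) -> 
  injective p -> (forall i j, q i <> p j) ->
  (forall i, path_in (U i) u (p i)) -> (forall i, path_in (A i) (a i) (p i)) ->
  (forall i, path_in (V i) v (q i)) -> (forall i, path_in (B i) (a i) (q i)) ->
  (forall i j, i != j -> path_in (T i j) (a i) (a j)) ->
  (forall i z, U i z -> J z -> z = p i) -> (forall i z, A i z -> J z -> z = p i) ->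
  (forall i z, B i z -> J z -> z = q i) ->
  (forall i j, i != j -> avoids (T i j) J) ->
  (forall i j, avoids (U i) (V j)) -> (forall i j, avoids (V i) (A j)) ->
  (forall i j k, j != k -> avoids (U i) (T j k)) ->
  (forall i j k, j != k -> avoids (V i) (T j k)) ->
  (forall i j, i != j -> avoids (U i) (A j)) ->
  (forall i j, i != j -> avoids (A i) (A j)) ->
  (forall i j, i != j -> avoids (B i) (A j)) ->
  (forall i j k, i != j -> i != k -> j != k -> avoids (A i) (T j k)) ->
  (forall i j k, i != j -> i != k -> j != k -> avoids (B i) (T j k)) ->
  False.
Proof.
move=> Jp Jq p_inj qp pU pA pV pB pT JU JA JB JT UV VA UT VT UA AA BA AT BT.
have param z : J z -> exists2 s : R, 0 <= s < 1 & z = f s.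
  case=> s; rewrite /= in_itv /= => s01 <-.
  by have [s1|s1] := ltP s 1; [exists s => //|exists 0; rewrite ?f_loop //; [|congr f]]; lra.
have /choice[sp spP] : forall i, exists s : R, 0 <= s < 1 /\ p i = f s.
  by move=> i; have [s s01 e] := param _ (Jp i); exists s.
have /choice[sq sqP] : forall i, exists s : R, 0 <= s < 1 /\ q i = f s.
  by move=> i; have [s s01 e] := param _ (Jq i); exists s.
have sp01 i : 0 <= sp i < 1 by case: (spP i).
have sq01 i : 0 <= sq i < 1 by case: (sqP i).
have spE i : p i = f (sp i) by case: (spP i).
have sqE i : q i = f (sq i) by case: (sqP i).
have sp_neq i j : i != j -> sp i != sp j.
  by apply: contra_neq => e; apply: p_inj; rewrite !spE e.
(* If both arcs of J between p_j and q_j met another p_i, then the chord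
   p_j a_j q_j would cross the chord p_i a_i a_k p_k. *)
have chord j i k lo hi SL SH : i != j -> k != j ->
    0 <= lo -> lo < sp i < hi -> hi < 1 -> ~ (lo <= sp k <= hi) ->
    path_in SL (a j) (f lo) -> path_in SH (a j) (f hi) ->
    (forall z, SL z -> J z -> z = f lo) -> (forall z, SH z -> J z -> z = f hi) ->
    avoids SL (A i) -> avoids SL (A k) -> avoids SH (A i) -> avoids SH (A k) ->
    avoids SL (T i k) -> avoids SH (T i k) -> False.
  move=> ij kj lo0 sihi hi1 sk pL pH JL JH Li Lk Hi Hk LT HT.
  have ik : i != k by apply/eqP => ik; apply: sk; rewrite -ik; lra.
  have Ck : path_in (T i k `|` A k) (a i) (f (sp k)).
    rewrite -spE; apply: (@path_in_trans _ _ (a k)).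
      by apply: (path_inW (@subsetUl _ _ _)); exact: pT.
    by apply: (path_inW (@subsetUr _ _ _)); exact: pA.
  have Ci : path_in (A i) (a i) (f (sp i)) by rewrite -spE.
  have Jk z : (T i k `|` A k) z -> J z -> z = f (sp k).
    by case=> [/(JT _ _ ik) Tz /Tz|/JA + /[dup] /[swap]]; rewrite // -spE => /[apply].
  have Ji z : A i z -> J z -> z = f (sp i) by rewrite -spE; exact: JA.
  have Lik : avoids SL (T i k `|` A k) by move=> z Lz [/(LT z Lz)|/(Lk z Lz)].
  have Hik : avoids SH (T i k `|` A k) by move=> z Hz [/(HT z Hz)|/(Hk z Hz)].
  (* In parameter order p_k comes before or after the other three points; either way the chord ends
     interlace. *)
  have := sp01 k; have [klo|klo] := ltP (sp k) lo => spk01.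
    apply: (@crossing_chords (sp k) lo (sp i) hi (a i) (a j)
      (T i k `|` A k) SL (A i) SH (T i j)) => //; try lra.
    - exact: pT.
    - exact: JT.
    - exact: avoids_sym.
    - exact: avoids_sym.
    - exact: avoids_sym.
    - exact: avoids_sym.
  have khi : hi < sp k by rewrite ltNge; apply/negP => hk; apply: sk; lra.
  apply: (@crossing_chords lo (sp i) hi (sp k) (a j) (a i)
     SL (A i) SH (T i k `|` A k) (T j i)) => //; try lra.
  - by apply: pT; rewrite eq_sym.
  - by apply: JT; rewrite eq_sym.
have arcs j : exists K, [/\ path_in K (q j) (p j), K `<=` J &
    forall i, i != j -> ~ K (p i)].
  pose lo := Num.min (sp j) (sq j); pose hi := Num.max (sp j) (sq j).
  have [lo0 lohi hi1] : [/\ 0 <= lo, lo <= hi & hi < 1].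
    have := sp01 j; have := sq01 j; rewrite /lo /hi.
    by case: (leP (sp j) (sq j)) => *; split; lra.
  have path_qp K : path_in K (f lo) (f hi) -> path_in K (q j) (p j).
    rewrite spE sqE /lo /hi; case: (leP (sp j) (sq j)) => // _.
    exact: path_in_sym.
  have [inside|/existsNP[k /not_implyP[kj kout]]] :=
    pselect (forall k, k != j -> lo < sp k < hi).
    exists (coarc lo hi); split.
    - by apply: path_qp; apply: path_coarc; lra.
    - by apply: coarc_sub; lra.
    - by move=> i ij; rewrite spE; apply: coarcN; [lra|lra|exact: inside].
  have [outside|/existsNP[i /not_implyP[ij iin]]] :=
    pselect (forall i, i != j -> ~ (lo <= sp i <= hi)).
    exists (arc lo hi); split.
    - by apply: path_qp; apply: path_arc; lra.
    - by apply: arc_sub; lra.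
    - by move=> i ij; rewrite spE; apply: arcN; [lra|lra|exact: sp01|exact: outside].
  (* Here p_i lies on one arc between p_j and q_j, and p_k on the other. As both differ from p_j and
     q_j, the inequalities become those required by [chord]. *)
  exfalso.
  have sq_neq i' : sq j != sp i'.
    by apply/eqP => e; apply: (qp j i'); rewrite spE sqE e.
  have iin' : lo < sp i < hi.
    move: iin => /contrapT iin; have := sp_neq _ _ ij; have := sq_neq i.
    move: iin; rewrite /lo /hi; case: (leP (sp j) (sq j)) => _ /andP[l1 l2] n1 n2.
      by rewrite !lt_neqAle l1 l2 eq_sym n2 eq_sym n1.
    by rewrite !lt_neqAle l1 l2 n1 n2.
  have kout' : ~ (lo <= sp k <= hi).
    move=> kin; apply: kout; have := sp_neq _ _ kj; have := sq_neq k.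
    move: kin; rewrite /lo /hi; case: (leP (sp j) (sq j)) => _ /andP[l1 l2] n1 n2.
      by rewrite !lt_neqAle l1 l2 eq_sym n2 eq_sym n1.
    by rewrite !lt_neqAle l1 l2 n1 n2.
  have ik : i != k by apply/eqP => e; apply: kout'; rewrite -e; lra.
  have [ji jk] : j != i /\ j != k by rewrite ![j == _]eq_sym.
  have cA := pA j; have cB := pB j; rewrite spE in cA; rewrite sqE in cB.
  have cJA z : A j z -> J z -> z = f (sp j) by rewrite -spE; exact: JA.
  have cJB z : B j z -> J z -> z = f (sq j) by rewrite -sqE; exact: JB.
  move: lo0 iin' hi1 kout'; rewrite /lo /hi.
  case: (leP (sp j) (sq j)) => _ lo0 iin' hi1 kout'.
    by apply: (chord j i k (sp j) (sq j) (A j) (B j)) => //; auto.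
  by apply: (chord j i k (sq j) (sp j) (B j) (A j)) => //; auto.
have /choice[K KP] := arcs.
(* In the final K_{3,3}, u reaches p_j along U_j, v along V_j followed by K_j, and a_0 along A_j,
   preceded by the edge a_0 a_j if j is not 0. *)
pose W (i : 'I_3) := if i == ord0 then A i else T ord0 i `|` A i.
have WP i z : W i z -> A i z \/ (i != ord0 /\ T ord0 i z).
  by rewrite /W; case: eqP => [_|/eqP i0] => [|[]]; auto.
apply: (@K33_no_paths R (fun i => nth 0 [:: u; v; a ord0] i) p
   (fun i j => nth set0 [:: U j; V j `|` K j; W j] i)).
  move=> [[|[|[|//]]] ?] j //=.
    have [pK _ _] := KP j; apply: (@path_in_trans _ _ (q j)).
      by apply: (path_inW (@subsetUl _ _ _)); exact: pV.
    by apply: (path_inW (@subsetUr _ _ _)).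
  rewrite /W; case: eqP => [->|/eqP j0]; first exact: pA.
  apply: (@path_in_trans _ _ (a j)).
    by apply: (path_inW (@subsetUl _ _ _)); apply: pT; rewrite eq_sym.
  by apply: (path_inW (@subsetUr _ _ _)); exact: pA.
have UVK i j : i != j -> avoids (U i) (V j `|` K j).
  move=> ij z Uz [/(UV i j z Uz)//|Kz]; have [_ KJ Kp] := KP j.
  by apply: (Kp i ij); rewrite -(JU i z Uz) //; exact: KJ.
have UW i j : i != j -> avoids (U i) (W j).
  move=> ij z Uz /WP[/(UA i j ij z Uz)//|[j0]].
  by apply: UT Uz; rewrite eq_sym.
have VW i j : i != j -> avoids (V i `|` K i) (W j).
  move=> ij z [Vz|Kz] /WP[Az|[j0 Tz]].
  - exact: VA Vz Az.
  - by apply: VT Vz Tz; rewrite eq_sym.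
  - have [_ KJ Kp] := KP i.
    by apply: (Kp j); [rewrite eq_sym|rewrite -(JA j z Az) //; exact: KJ].
  - have [_ KJ _] := KP i; apply: (JT _ _ _ z Tz (KJ z Kz)).
    by rewrite eq_sym.
move=> [[|[|[|//]]] ?] j [[|[|[|//]]] ?] l z //= _ jl z1 z2.
- exact: UVK jl z z1 z2.
- exact: UW jl z z1 z2.
- by apply: (UVK l j _ z z2 z1); rewrite eq_sym.
- exact: VW jl z z1 z2.
- by apply: (UW l j _ z z2 z1); rewrite eq_sym.
- by apply: (VW l j _ z z2 z1); rewrite eq_sym.
Qed.

End JordanCurve.

(** * Edges of a drawing against the boundary of one cluster region *)

Lemma eq_set2 (T : finType) (x y x' y' : T) :
  [set x; y]%SET = [set x'; y']%SET -> x = x' /\ y = y' \/ x = y' /\ y = x'.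
Proof.
move=> e.
have : x \in [set x'; y']%SET by rewrite -e !inE eqxx.
have : y \in [set x'; y']%SET by rewrite -e !inE eqxx orbT.
have : x' \in [set x; y]%SET by rewrite e !inE eqxx.
have : y' \in [set x; y]%SET by rewrite e !inE eqxx orbT.
by rewrite !inE => /orP[] /eqP ? /orP[] /eqP ? /orP[] /eqP ? /orP[] /eqP ?; subst; auto.
Qed.

Lemma adj_edge (G : sgraph) (x y : vertex G) : adj x y ->
  exists e : edge G, val e = [set x; y]%SET.
Proof.
move=> xy; have xyE : [set x; y]%SET \in edge_set G.
  by rewrite inE; apply/existsP; exists x; apply/existsP; exists y; rewrite xy eqxx.
by exists (Sub [set x; y]%SET xyE : edge G); rewrite SubK.
Qed.

Section Drawing.
Variables (R : realType) (C : clustered_graph) (D : drawing R C).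
Local Notation plane := (plane R).
Local Notation pt := (point_of D).
Hypothesis D_drawing : is_drawing D.
Hypothesis D_planar : no_edge_edge_crossing D.

(** An edge curve named by its end vertices; empty if they are not adjacent. *)
Definition curve_of (x y : vertex C) : set plane :=
  [set z | exists2 e : edge C, val e = [set x; y]%SET & open_curve D e z].

Lemma pt_inj : injective pt.
Proof. by case: (drawing_graphP D_drawing). Qed.

Lemma curve_of_pt x y w : ~ curve_of x y (pt w).
Proof. by case: (drawing_graphP D_drawing) => _ _ _ H [e _]; exact: H. Qed.

Lemma curve_of_disjoint x y x' y' z : curve_of x y z -> curve_of x' y' z ->
  x = x' /\ y = y' \/ x = y' /\ y = x'.
Proof.
move=> [e eE ez] [e' e'E e'z]; apply: eq_set2; rewrite -eE -e'E.
have [->//|ee'] := eqVneq e e'.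
by have := D_planar ee' => /seteqP[+ _] => /(_ z (conj ez e'z)).
Qed.

(** The drawing does not fix the direction of an arc, so it is reversed if it runs from y to x. *)
Lemma edge_param x y : adj x y ->
  exists g : R -> plane, [/\ {within `[0, 1], continuous g},
    {in `[0, 1] &, injective g}, g 0 = pt x /\ g 1 = pt y &
    forall z, curve_of x y z <-> exists2 t, 0 < t < 1 & z = g t].
Proof.
move=> xy; have [e eE] := adj_edge xy.
have [_ /(_ e)[ce ie] /(_ e)[x' [y' [eE' e0 e1]]] _] := drawing_graphP D_drawing.
have curveE z : curve_of x y z <-> exists2 t, 0 < t < 1 & z = arc_of D e t.
  split=> [[e' e'E [t]]|[t t01 ->]].
    rewrite /= in_itv /= => t01 <-; exists t => //.
    by rewrite (_ : e' = e) //; apply: val_inj; rewrite e'E eE.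
  by exists e => //; exists t => //=; rewrite in_itv.
have := eq_set2 (etrans (esym eE) eE') => -[[xx' yy']|[xy' yx']]; subst x' y'.
  by exists (arc_of D e).
exists (fun t => arc_of D e (1 - t)); split=> [||//|z].
- have c1 : continuous (fun t : R => 1 - t).
    by move=> t; apply: cvgB; [exact: cvg_cst|exact: cvg_id].
  have cc := continuous_reparam c1 (within_clamp_continuous ce).
  have eqc : {in `[0%R, 1%R]%classic, (fun t => (arc_of D e \o clamp (R := R)) (1 - t)) =1
      (fun t => arc_of D e (1 - t))}.
    move=> t; rewrite inE /= in_itv /= => t01.
    by rewrite clamp_id //; lra.
  exact: subspace_eq_continuous eqc (continuous_subspaceT cc).
- move=> s t; rewrite !inE /= !in_itv /= => s01 t01 /ie st.
  have : 1 - s = 1 - t by apply: st; rewrite inE /= in_itv /=; lra.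
  by lra.
- by rewrite subr0 subrr.
- rewrite curveE; split=> -[t t01 ->]; exists (1 - t); rewrite ?subKr //; lra.
Qed.

Variable mu : Defs.cluster C.
Let J := frontier (region D mu).
Hypothesis one_crossing : forall (e : edge C) z z',
  open_curve D e z -> J z -> open_curve D e z' -> J z' -> z = z'.

Lemma curve_of_one_crossing x y z z' :
  curve_of x y z -> J z -> curve_of x y z' -> J z' -> z = z'.
Proof.
move=> [e eE ez] Jz [e' e'E ez'] Jz'; apply: (one_crossing ez Jz) Jz'.
by rewrite (_ : e = e') //; apply: val_inj; rewrite eE e'E.
Qed.

(* The part on the side of x of the edge xy, which crosses J at p only. *)
Definition spoke (x y : vertex C) (p : plane) : set plane :=
  [set z | (z = pt x \/ curve_of x y z) /\ (J z -> z = p)].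

Lemma Jpt x : ~ J (pt x).
Proof. exact: drawing_vertices_off_frontier. Qed.

Lemma curve_ofC x y : curve_of x y = curve_of y x.
Proof. by rewrite /curve_of finset.setUC. Qed.

(** An edge missing J would lead from the region to an outside vertex, against
    [path_avoids_frontier]. The edge is cut at its only crossing. *)
Lemma spokes x y : adj x y -> x \notin cluster_vertices mu ->
  y \in cluster_vertices mu ->
  exists p, [/\ J p, curve_of x y p, path_in (spoke x y p) (pt x) p
    & path_in (spoke y x p) (pt y) p].
Proof.
move=> xy xmu ymu.
have [g [cg ig [g0 g1] gE]] := edge_param xy.
have [s [s01 Js]] : exists s, 0 < s < 1 /\ J (g s).
  apply: contrapT => noJ.
  have : interior (region D mu) (pt x).
    apply: (@path_avoids_frontier _ _ (pt y)); last exact/(drawing_vertices D_drawing).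
    apply: path_in_sym; rewrite -g0 -g1.
    apply: (subpath_in cg); rewrite ?lexx ?ler01 // => t t01.
    have [t0|t0] := eqVneq t 0; first by rewrite t0 g0; exact: Jpt.
    have [t1|t1] := eqVneq t 1; first by rewrite t1 g1; exact: Jpt.
    by move=> Jt; apply: noJ; exists t; split=> //; rewrite !lt_neqAle eq_sym t0 t1.
  by move/interior_subset/(drawing_vertices D_drawing); rewrite (negbTE xmu).
have cs : curve_of x y (g s) by apply/gE; exists s.
have sub t : 0 <= t <= 1 -> J (g t) -> g t = g s.
  have [->|t0] := eqVneq t 0; first by rewrite g0 => _ /Jpt.
  have [->|t1] := eqVneq t 1; first by rewrite g1 => _ /Jpt.
  move=> t01 Jt; apply: (@curve_of_one_crossing x y) => //; apply/gE; exists t => //.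
  by rewrite !lt_neqAle eq_sym t0 t1.
exists (g s); split=> //.
  rewrite -g0; apply: (subpath_in cg); [lra|lra|lra|move=> t ts].
  split; last by apply: sub; lra.
  have [->|t0] := eqVneq t 0; first by left.
  right; apply/gE; exists t => //; rewrite lt_neqAle eq_sym t0; lra.
rewrite -g1; apply: path_in_sym.
apply: (subpath_in cg); [lra|lra|lra|move=> t ts].
split; last by apply: sub; lra.
have [->|t1] := eqVneq t 1; first by left.
right; rewrite curve_ofC; apply/gE; exists t => //; rewrite [t < 1]lt_neqAle t1; lra.
Qed.

(* At a single crossing both sides of the boundary would locally belong to the
   region, so the crossing point would be interior. *)
Lemma inner_edge_off_frontier x y z : adj x y ->
  x \in cluster_vertices mu -> y \in cluster_vertices mu ->
  curve_of x y z -> ~ J z.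
Proof.
move=> xy xmu ymu cz Jz.
have [g [cg ig [g0 g1] gE]] := edge_param xy.
have [s s01 zs] : exists2 t, 0 < t < 1 & z = g t by apply/gE.
(* Since z is the only point of J on the edge, any other point is reached from an end vertex along
   the edge without meeting J. *)
have inside z' : curve_of x y z' -> z' <> z -> interior (region D mu) z'.
  move=> /gE[t t01 z't] z'z.
  have ts : t != s by apply/eqP => ts; apply: z'z; rewrite z't zs ts.
  have offJ r : 0 <= r <= 1 -> r != s -> ~ J (g r).
    move=> r01 rs; have [->|r0] := eqVneq r 0; first by rewrite g0; exact: Jpt.
    have [->|r1] := eqVneq r 1; first by rewrite g1; exact: Jpt.
    move=> Jr; move/eqP: rs; apply; apply: ig.
    - by rewrite inE /= in_itv.
    - by rewrite inE /= in_itv /=; lra.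
    apply: (@curve_of_one_crossing x y) => //; rewrite -?zs //; apply/gE.
    by exists r => //; rewrite !lt_neqAle eq_sym r0 r1.
  rewrite z't; move: ts; rewrite neq_lt => /orP[ts|ts].
    apply: (@path_avoids_frontier _ _ (pt x)); last exact/(drawing_vertices D_drawing).
    rewrite -g0; apply: (subpath_in cg); [lra|lra|lra|move=> r rt].
    apply: offJ; first by lra.
    by rewrite lt_eqF //; lra.
  apply: (@path_avoids_frontier _ _ (pt y)); last exact/(drawing_vertices D_drawing).
  rewrite -g1; apply: path_in_sym; apply: (subpath_in cg); [lra|lra|lra|move=> r rt].
  apply: offJ; first by lra.
  by rewrite gt_eqF //; lra.
have [e eE ez] := cz.
have [h [ch ih oh h0 hE]] :
    alternate (curve D (inl e)) (curve D (inr mu)) z.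
  by apply: (drawing_alternate D_drawing).
have eC z' : open_curve D e z' -> curve_of x y z' by exists e.
(* In the chart [h] the edge is the horizontal axis and J the vertical one: a vertical segment joins
   the point to the edge and misses J. *)
have offaxis w : w.1 != 0 -> interior (region D mu) (h w).
  move=> w1.
  apply: (@path_avoids_frontier _ _ (h (w.1, 0))).
    have cw : continuous (fun t : R => (w.1, t * w.2) : plane).
      move=> t; have c1 : (fun=> w.1) @ t --> w.1 by exact: cvg_cst.
      have c2 : (fun t => t * w.2) @ t --> t * w.2 by apply: cvgMl; exact: cvg_id.
      exact: (cvg_pair c1 c2).
    exists (fun t => h (w.1, t * w.2)); split.
    - by move=> t; exact: continuous_comp (cw t) (ch _).
    - by rewrite mul0r.
    - by rewrite mul1r; case: (w).
    - by move=> t _ /(proj2 (hE (w.1, t * w.2))) /=; move/eqP: w1.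
  apply: interior_subset; apply: inside.
    by apply: eC; apply/(proj1 (hE (w.1, 0))).
  by rewrite -h0 => /ih[] /eqP; rewrite (negbTE w1).
have [_ regE _ _] := drawing_regionP D_drawing mu.
(* Points of the vertical axis are limits of the previous ones, and the region is closed. *)
have hR w : region D mu (h w).
  have [w1|] := eqVneq w.1 0; last by move/offaxis/interior_subset.
  rewrite regE => B /ch hB.
  have /nbhs_ballP[r /= r0 rB] : nbhs w (h @^-1` B) by [].
  have w'B : B (h (w.1 + r / 2, w.2)).
    apply: rB; split; rewrite /ball /= ?subrr ?normr0 //.
    by rewrite opprD addNKr normrN ger0_norm; lra.
  exists (h (w.1 + r / 2, w.2)); split=> //.
  by apply: offaxis; rewrite /= w1 add0r; apply/eqP; lra.
apply: (proj2 Jz); rewrite /interior.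
have : open_nbhs z (h @` setT).
  by split; [apply: oh; exact: openT|exists (0, 0)].
move/open_nbhs_nbhs; apply: filterS => _ [w _ <-]; exact: hR.
Qed.

(** The six edges at u and v are cut into spokes and the triangle edges stay off J, which is the
    configuration excluded by [no_bipyramid_drawing]. *)
Lemma no_bipyramid_cluster (u v : vertex C) (a : 'I_3 -> vertex C) :
  injective a -> u != v -> u \notin cluster_vertices mu ->
  v \notin cluster_vertices mu -> (forall i, a i \in cluster_vertices mu) ->
  (forall i, adj u (a i)) -> (forall i, adj v (a i)) ->
  ~ (forall i j, i != j -> adj (a i) (a j)).
Proof.
move=> a_inj /eqP uv umu vmu amu ua va aa.
have /choice[p pP] := fun i => spokes (ua i) umu (amu i).
have /choice[q qP] := fun i => spokes (va i) vmu (amu i).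
have uaN i : u <> a i by move=> e; move: umu; rewrite e amu.
have vaN i : v <> a i by move=> e; move: vmu; rewrite e amu.
have auN i : a i <> u by move=> /esym; exact: uaN.
have avN i : a i <> v by move=> /esym; exact: vaN.
have vu : v <> u by move=> /esym.
have [_ _ _ [f [cf fl fi JE]]] := drawing_regionP D_drawing mu.
pose T i j : set plane := [set z | (z = pt (a i) \/ z = pt (a j) \/
  curve_of (a i) (a j) z) /\ ~ J z].
have TP i j : i != j -> path_in (T i j) (pt (a i)) (pt (a j)).
  move=> ij; have [g [cg ig [g0 g1] gE]] := edge_param (aa i j ij).
  rewrite -g0 -g1; apply: (subpath_in cg); rewrite ?lexx ?ler01 // => t t01.
  rewrite /T /= -g0 -g1.
  have [->|t0] := eqVneq t 0; first by rewrite g0; split; [left|exact: Jpt].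
  have [->|t1] := eqVneq t 1; first by rewrite g1; split; [right; left|exact: Jpt].
  have ct : curve_of (a i) (a j) (g t).
    by apply/gE; exists t => //; rewrite !lt_neqAle eq_sym t0 t1.
  split; first by right; right.
  exact: inner_edge_off_frontier (aa i j ij) (amu i) (amu j) ct.
(* Every point of these paths is a vertex or lies on a single edge, so two of
   them can only meet in a common vertex or along a common edge. *)
have sep (x y x' y' : vertex C) z : curve_of x y z -> curve_of x' y' z ->
    (x = x' -> y = y' -> False) -> (x = y' -> y = x' -> False) -> False.
  by move=> c c'; case: (curve_of_disjoint c c') => -[e e'] H1 H2; [exact: H1|exact: H2].
have ptN x y : x <> y -> pt x <> pt y by move=> xy /pt_inj.
have aN i j : i != j -> a i <> a j by move=> /eqP ij /a_inj.
have pc x y w z : z = pt w -> curve_of x y z -> False.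
  by move=> ->; exact: curve_of_pt.
apply: (@no_bipyramid_drawing R f cf fl fi (pt u) (pt v) (fun i => pt (a i)) p q
  (fun i => spoke u (a i) (p i)) (fun i => spoke (a i) u (p i))
  (fun i => spoke v (a i) (q i)) (fun i => spoke (a i) v (q i)) T); rewrite -?JE.
- by move=> i; case: (pP i).
- by move=> i; case: (qP i).
- move=> i j pij; case: (pP i) (pP j) => _ ci _ _ [_ cj _ _].
  rewrite pij in ci; case: (curve_of_disjoint ci cj) => -[]; first by move=> _ /a_inj.
  by move=> /uaN.
- move=> i j qp; case: (qP i) (pP j) => _ ci _ _ [_ cj _ _].
  by rewrite qp in ci; case: (curve_of_disjoint ci cj) => -[// /vaN].
- by move=> i; case: (pP i).
- by move=> i; case: (pP i).
- by move=> i; case: (qP i).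
- by move=> i; case: (qP i).
- exact: TP.
- by move=> i z [].
- by move=> i z [].
- by move=> i z [].
- by move=> i j ij z [].
- move=> i j z [[zu|c] _] [[zv|c'] _].
  + by move: zv; rewrite zu; exact: ptN.
  + exact: pc zu c'.
  + exact: pc zv c.
  + by apply: (sep _ _ _ _ _ c c') => // /uaN.
- move=> i j z [[zu|c] _] [[zv|c'] _].
  + by move: zv; rewrite zu; exact: ptN.
  + exact: pc zu c'.
  + exact: pc zv c.
  + by apply: (sep _ _ _ _ _ c c') => // /vaN.
- move=> i j k jk z [[zu|c] _] [[zv|[zv|c']] _].
  + by move: zv; rewrite zu; exact: ptN.
  + by move: zv; rewrite zu; exact: ptN.
  + exact: pc zu c'.
  + exact: pc zv c.
  + exact: pc zv c.
  + by apply: (sep _ _ _ _ _ c c') => // /uaN.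
- move=> i j k jk z [[zu|c] _] [[zv|[zv|c']] _].
  + by move: zv; rewrite zu; exact: ptN.
  + by move: zv; rewrite zu; exact: ptN.
  + exact: pc zu c'.
  + exact: pc zv c.
  + exact: pc zv c.
  + by apply: (sep _ _ _ _ _ c c') => // /vaN.
- move=> i j ij z [[zu|c] _] [[zv|c'] _].
  + by move: zv; rewrite zu; exact: ptN.
  + exact: pc zu c'.
  + exact: pc zv c.
  + by apply: (sep _ _ _ _ _ c c') => [/uaN//|_]; exact: aN.
- move=> i j ij z [[zu|c] _] [[zv|c'] _].
  + by move: zv; rewrite zu; apply: ptN; exact: aN.
  + exact: pc zu c'.
  + exact: pc zv c.
  + by apply: (sep _ _ _ _ _ c c') => [/(aN _ _ ij)//|/auN].
- move=> i j ij z [[zu|c] _] [[zv|c'] _].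
  + by move: zv; rewrite zu; apply: ptN; exact: aN.
  + exact: pc zu c'.
  + exact: pc zv c.
  + by apply: (sep _ _ _ _ _ c c') => [/(aN _ _ ij)//|/auN].
- move=> i j k ij ik jk z [[zu|c] _] [[zv|[zv|c']] _].
  + by move: zv; rewrite zu; apply: ptN; exact: aN.
  + by move: zv; rewrite zu; apply: ptN; exact: aN.
  + exact: pc zu c'.
  + exact: pc zv c.
  + exact: pc zv c.
  + by apply: (sep _ _ _ _ _ c c') => [/(aN _ _ ij)|/(aN _ _ ik)].
- move=> i j k ij ik jk z [[zu|c] _] [[zv|[zv|c']] _].
  + by move: zv; rewrite zu; apply: ptN; exact: aN.
  + by move: zv; rewrite zu; apply: ptN; exact: aN.
  + exact: pc zu c'.
  + exact: pc zv c.
  + exact: pc zv c.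
  + by apply: (sep _ _ _ _ _ c c') => [/(aN _ _ ij)|/(aN _ _ ik)].
Qed.

End Drawing.

(** * Planarity from straight-line drawings *)

Section StraightLine.
Variable R : realType.
Local Notation plane := (plane R).

Definition seg (p q : plane) (t : R) : plane :=
  ((1 - t) * p.1 + t * q.1, (1 - t) * p.2 + t * q.2).

Lemma seg_continuous p q : continuous (seg p q).
Proof.
move=> t.
have c (x y : R) : (fun t => (1 - t) * x + t * y) @ t --> (1 - t) * x + t * y.
  apply: cvgD; apply: cvgMl; last exact: cvg_id.
  by apply: cvgB; [exact: cvg_cst|exact: cvg_id].
exact: cvg_pair (c p.1 q.1) (c p.2 q.2).
Qed.

Lemma seg_inj p q : p <> q -> injective (seg p q).
Proof.
case: p q => [p1 p2] [q1 q2] pq s t [] /= e1 e2.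
have [//|st] := eqVneq s t.
have st0 : t - s != 0 by rewrite subr_eq0 eq_sym.
have d1 : (t - s) * (q1 - p1) = 0 by lra.
have d2 : (t - s) * (q2 - p2) = 0 by lra.
case: pq; congr pair; apply/eqP; rewrite eq_sym -subr_eq0.
  by move/eqP: d1; rewrite mulf_eq0 (negbTE st0).
by move/eqP: d2; rewrite mulf_eq0 (negbTE st0).
Qed.

(** The relation [o] directs the edges, so that crossing segments can be compared as ordered pairs
    of ends. *)
Lemma straight_line_planar (G : sgraph) (pos : vertex G -> plane)
    (o : rel (vertex G)) :
  injective pos -> (forall x y, adj x y -> o x y || o y x) ->
  (forall x y, o x y -> x != y) ->
  (forall x y w t, o x y -> 0 < t < 1 -> seg (pos x) (pos y) t <> pos w) ->
  (forall x y x' y' s t, o x y -> o x' y' -> 0 < s < 1 -> 0 < t < 1 ->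
     seg (pos x) (pos y) s = seg (pos x') (pos y') t -> x = x' /\ y = y') ->
  planar R G.
Proof.
move=> pos_inj oriented o_irr off_vertex disj.
have /choice[xy xyP] : forall e : edge G, exists xy : vertex G * vertex G,
    o xy.1 xy.2 /\ val e = [set xy.1; xy.2]%SET.
  move=> e; have := valP e; rewrite inE => /existsP[x /existsP[y /andP[/oriented xy /eqP eE]]].
  by case/orP: xy => xy; [exists (x, y)|exists (y, x); rewrite finset.setUC].
exists (GraphDrawing pos (fun e => seg (pos (xy e).1) (pos (xy e).2))).
  split=> //=.
  - move=> e; split; first by apply: continuous_subspaceT; exact: seg_continuous.
    move=> s t _ _; apply: seg_inj => /pos_inj/eqP.
    by apply/negP; apply: o_irr; case: (xyP e).
  - move=> e; exists (xy e).1, (xy e).2; split; first by case: (xyP e).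
      by rewrite /seg subr0 !mul1r !mul0r !addr0; case: (pos _).
    by rewrite /seg subrr !mul1r !mul0r !add0r; case: (pos _).
  - move=> e v [t]; rewrite /= in_itv /= => t01; apply: off_vertex => //.
    by case: (xyP e).
move=> e e' ee'; apply/seteqP; split=> // z [[s]]; rewrite /= in_itv /= => s01 <- [t].
rewrite /= in_itv /= => t01 /esym st.
have [xo e1] := xyP e; have [yo e2] := xyP e'.
have [x1 x2] := disj _ _ _ _ _ _ xo yo s01 t01 st.
by move/eqP: ee'; apply; apply: val_inj; rewrite e1 e2 x1 x2.
Qed.

End StraightLine.

(** * The family of clustered graphs *)

Section Wheels.
Variable k : nat.

(* [None] is the common apex u; [Some (j, i)] is the vertex a_i of the j-th copy
   for i < 3, and its second apex v for i = 3. *)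
Definition bipyramids_adj (x y : option ('I_k * 'I_4)) : bool :=
  match x, y with
  | None, None => false
  | None, Some (_, i) | Some (_, i), None => (i < 3)%N
  | Some (j, i), Some (j', i') => (j == j') && (i != i')
  end.

Lemma bipyramids_adj_sym : symmetric bipyramids_adj.
Proof. by move=> [[j i]|] [[j' i']|] //=; rewrite eq_sym [i == _]eq_sym. Qed.

Lemma bipyramids_adj_irr : irreflexive bipyramids_adj.
Proof. by move=> [[j i]|] //=; rewrite !eqxx. Qed.

Definition bipyramids : sgraph := SGraph bipyramids_adj_sym bipyramids_adj_irr.

(** [None] is the root and [Some j] the triangle of copy j; all apexes are children of the root. *)
Definition bipyramids_parent (x : vertex bipyramids + option 'I_k) : option 'I_k :=
  if x is inl (Some (j, i)) then if (i < 3)%N then Some j else None else None.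

Lemma bipyramids_parent_root : bipyramids_parent (inr None) = None.
Proof. by []. Qed.

Lemma bipyramids_parent_to_root mu :
  fconnect (fun nu => bipyramids_parent (inr nu)) mu None.
Proof. by apply: connect1; rewrite /= eqxx. Qed.

Lemma bipyramids_cluster_child mu : exists2 x, x != inr None & bipyramids_parent x = mu.
Proof.
case: mu => [j|]; last by exists (inl None).
by exists (inl (Some (j, ord0))).
Qed.

Definition bipyramid_clusters : clustered_graph :=
  ClusteredGraph bipyramids_parent_root bipyramids_parent_to_root bipyramids_cluster_child.

Lemma bipyramids_descendant (mu nu : Defs.cluster bipyramid_clusters) :
  descendant mu nu = (nu == None) || (mu == nu).
Proof.
rewrite /descendant; apply/idP/orP => [|[/eqP->|/eqP->]]; last 2 first.
- exact: bipyramids_parent_to_root.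
- exact: connect0.
case/connectP => p; elim: p mu => [|x p IH] mu /= => [_ ->|/andP[/eqP <- px] nuE].
  by right.
by case: (IH _ px nuE) => [|/eqP <-]; left; rewrite ?eqxx.
Qed.

Lemma bipyramids_cluster_root (x : vertex bipyramids) :
  x \in cluster_vertices (Defs.root bipyramid_clusters).
Proof. by rewrite inE bipyramids_descendant eqxx. Qed.

Lemma bipyramids_cluster (j : 'I_k) (x : vertex bipyramids) :
  (x \in cluster_vertices (Some j : Defs.cluster bipyramid_clusters)) =
  if x is Some (j', i) then (j' == j) && (i < 3)%N else false.
Proof.
by rewrite inE bipyramids_descendant; case: x => [[j' i]|] //=; case: ifP; rewrite ?andbT ?andbF.
Qed.

Lemma bipyramids_flat : flat bipyramid_clusters.
Proof. by move=> mu nu /negbTE mu0; rewrite bipyramids_descendant [mu == None]mu0 => /eqP. Qed.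

Lemma bipyramids_c_connected : c_connected bipyramid_clusters.
Proof.
move=> [j|] x y.
  rewrite !bipyramids_cluster; case: x y => [[j1 i1]|] // [[j2 i2]|] //.
  case/andP => /eqP-> i13 /andP[/eqP-> i23].
  have [->|i12] := eqVneq i1 i2; first exact: connect0.
  by apply: connect1; rewrite /= !bipyramids_cluster !eqxx i13 i23.
move=> _ _; set e := (X in connect X).
have e_sym : connect_sym e.
  apply: sym_connect_sym => a b.
  by rewrite /e /= !bipyramids_cluster_root /=; exact: bipyramids_adj_sym.
have eE a b : bipyramids_adj a b -> e a b by rewrite /e /= !bipyramids_cluster_root.
(* The vertices a_i are adjacent to the common apex, and v reaches it through a_0. *)
have hub a : connect e a None.
  case: a => [[j i]|]; last exact: connect0.
  have [i3|i3] := boolP (i < 3)%N; first by apply: connect1; apply: eE.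
  apply: (@connect_trans _ _ (Some (j, ord0))); apply: connect1; apply: eE => //=.
  by rewrite eqxx; apply: contraNneq i3 => ->.
by apply: connect_trans (hub x) _; rewrite e_sym.
Qed.

Lemma bipyramids_card : #|vertex bipyramids| = (k * 4).+1.
Proof. by rewrite card_option card_prod !card_ord. Qed.

End Wheels.

(** * A planar straight-line drawing of the family *)

Section WheelsPlanar.
Variables (R : realType) (k : nat).
Local Notation plane := (plane R).

(* The points u, a_0, a_1, a_2, v of one copy, in the cone 0 <= y <= 3 x; shearing
   moves the copies to cones that meet only at u. *)
Definition bipyramid_pos (m : nat) : plane :=
  nth (0, 0) [:: (0, 0); (4, 0); (4, 12); (2, 3); (3, 4)] m.

Definition shear (j : nat) (p : plane) : plane := (p.1, p.2 + 4 * j%:R * p.1).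

(** Positions are 0 for u, 1 to 3 for the a_i and 4 for v; u v is the missing edge of K5. *)
Definition bipyramid_edge (m n : nat) : bool := [&& n <= 4, m < n & (m, n) != (0, 4)]%N.

Lemma bipyramid_pos_cone m : (0 < m <= 4)%N ->
  0 < (bipyramid_pos m).1 /\ 0 <= (bipyramid_pos m).2 <= 3 * (bipyramid_pos m).1.
Proof. by case: m => [|[|[|[|[|]]]]] //= _; lra. Qed.

Lemma bipyramid_seg_cone m n t : bipyramid_edge m n -> 0 < t < 1 ->
  let p := seg (bipyramid_pos m) (bipyramid_pos n) t in
  0 < p.1 /\ 0 <= p.2 <= 3 * p.1.
Proof.
by move: m n => [|[|[|[|[|m]]]]] [|[|[|[|[|n]]]]] // _ t01; rewrite /seg /=; lra.
Qed.

Lemma bipyramid_seg_vertex m n l t : bipyramid_edge m n -> (l <= 4)%N -> 0 < t < 1 ->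
  seg (bipyramid_pos m) (bipyramid_pos n) t <> bipyramid_pos l.
Proof.
by move: m n l => [|[|[|[|[|m]]]]] [|[|[|[|[|n]]]]] // [|[|[|[|[|l]]]]] // _ _ t01;
  rewrite /seg /= => -[] *; lra.
Qed.

(** In the chosen coordinates a_2 lies inside the triangle u a_0 a_1, and v inside a_0 a_1 a_2. Each
    pair of the nine segments is settled by linear arithmetic. *)
Lemma bipyramid_seg_disjoint m n m' n' s t : bipyramid_edge m n -> bipyramid_edge m' n' ->
  0 < s < 1 -> 0 < t < 1 ->
  seg (bipyramid_pos m) (bipyramid_pos n) s = seg (bipyramid_pos m') (bipyramid_pos n') t ->
  m = m' /\ n = n'.
Proof.
by move: m n m' n' => [|[|[|[|[|m]]]]] [|[|[|[|[|n]]]]] // [|[|[|[|[|m']]]]]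
  [|[|[|[|[|n']]]]] // _ _ s01 t01; rewrite /seg /= => -[] *;
  first [split; reflexivity | exfalso; lra].
Qed.

Lemma shear_seg j p q t : seg (shear j p) (shear j q) t = shear j (seg p q t).
Proof. by rewrite /seg /shear /=; congr pair; ring. Qed.

(** After the shear, copy j occupies the slopes from 4j to 4j + 3, and these intervals are
    disjoint. *)
Lemma shear_cone_inj j j' p p' : 0 < p.1 -> 0 <= p.2 <= 3 * p.1 ->
  0 <= p'.2 <= 3 * p'.1 -> shear j p = shear j' p' -> j = j' /\ p = p'.
Proof.
case: p p' => [x y] [x' y'] /= x0 y0 y'0 [x'E e]; subst x'.
have [jj'|jj'|jj'] := ltngtP j j'.
- have jle : j%:R + 1 <= j'%:R :> R by rewrite natr1 ler_nat.
  by exfalso; nra.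
- have jle : j'%:R + 1 <= j%:R :> R by rewrite natr1 ler_nat.
  by exfalso; nra.
- by split=> //; congr pair; move: e; rewrite jj'; lra.
Qed.

Definition bipyramids_pos (x : vertex (bipyramids k)) : plane :=
  if x is Some (j, i) then shear j (bipyramid_pos i.+1) else (0, 0).

Definition bipyramids_oriented (x y : vertex (bipyramids k)) : bool :=
  match x, y with
  | None, Some (_, i) => (i < 3)%N
  | Some (j, i), Some (j', i') => (j == j') && (i < i')%N
  | _, _ => false
  end.

Definition place (x : vertex (bipyramids k)) : nat := if x is Some (_, i) then i.+1 else 0%N.

Lemma bipyramids_orientedP x y : bipyramids_oriented x y -> exists j : 'I_k,
  [/\ bipyramid_edge (place x) (place y),
    x = None \/ exists i, x = Some (j, i) & exists i, y = Some (j, i)].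
Proof.
move: x y => [[j i]|] [[j' i']|] //=.
  case/andP => /eqP-> ii'; exists j'; split; last by exists i'.
    by rewrite /bipyramid_edge /= (ltn_ord i') ltnS ii'.
  by right; exists i.
move=> i3; exists j'; split; [|by left|by exists i'].
by rewrite /bipyramid_edge /= xpair_eqE /= eqSS ltn_eqF // (leq_trans i3).
Qed.

Lemma place_inj x y (j : 'I_k) : (x = None \/ exists i, x = Some (j, i)) ->
  (y = None \/ exists i, y = Some (j, i)) -> place x = place y -> x = y.
Proof.
by move=> [->|[i ->]] [->|[i' ->]] //= [] /val_inj ->.
Qed.

Lemma bipyramids_posE x (j : 'I_k) : (x = None \/ exists i, x = Some (j, i)) ->
  bipyramids_pos x = shear j (bipyramid_pos (place x)).
Proof. by move=> [->|[i ->]] //=; rewrite /shear /= mulr0 addr0. Qed.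

Lemma bipyramids_planar : planar R (bipyramids k).
Proof.
apply: (@straight_line_planar R (bipyramids k) bipyramids_pos bipyramids_oriented).
- move=> [[j i]|] [[j' i']|] //=.
  + have [i0 ic] := @bipyramid_pos_cone i.+1 (ltn_ord i).
    have [_ i'c] := @bipyramid_pos_cone i'.+1 (ltn_ord i').
    move=> /(shear_cone_inj i0 ic i'c)[/val_inj -> e]; congr (Some (_, _)).
    apply: val_inj; move: e; clear.
    by case: i i' => [[|[|[|[|//]]]] ?] [[|[|[|[|//]]]] ?] //= [] *; exfalso; lra.
  + by have [i0 _] := @bipyramid_pos_cone i.+1 (ltn_ord i) => -[e]; rewrite e ltxx in i0.
  + by have [i0 _] := @bipyramid_pos_cone i'.+1 (ltn_ord i') => -[e]; rewrite -e ltxx in i0.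
- move=> [[j i]|] [[j' i']|] //=; rewrite ?orbF // => /andP[/eqP-> ii'].
  by rewrite eqxx /= -neq_ltn.
- move=> [[j i]|] [[j' i']|] //= /andP[_ ii'].
  by apply/eqP => -[_ e]; rewrite e ltnn in ii'.
- move=> x y w t /bipyramids_orientedP[j [xy xj yj]] t01.
  rewrite (bipyramids_posE xj) (bipyramids_posE (or_intror yj)) shear_seg.
  have [p0 pc] := bipyramid_seg_cone xy t01.
  case: w => [[j' i]|] /=.
    have [_ ic] := @bipyramid_pos_cone i.+1 (ltn_ord i).
    by move=> /(shear_cone_inj p0 pc ic)[_]; exact: bipyramid_seg_vertex.
  by case=> e; rewrite /= in p0; lra.
- move=> x y x' y' s t /bipyramids_orientedP[j [xy xj yj]].
  move=> /bipyramids_orientedP[j' [x'y' xj' yj']] s01 t01.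
  rewrite (bipyramids_posE xj) (bipyramids_posE (or_intror yj)) shear_seg.
  rewrite (bipyramids_posE xj') (bipyramids_posE (or_intror yj')) shear_seg.
  have [p0 pc] := bipyramid_seg_cone xy s01.
  have [_ pc'] := bipyramid_seg_cone x'y' t01.
  move=> /(shear_cone_inj p0 pc pc')[/val_inj jj'].
  move=> /(bipyramid_seg_disjoint xy x'y' s01 t01)[xx' yy']; subst j'.
  by split; [exact: place_inj xj xj' xx'|exact: place_inj (or_intror yj) (or_intror yj') yy'].
Qed.

End WheelsPlanar.

(** * The linear lower bound *)

Lemma card_eq_le1 (T : Type) (A : set T) (n : nat) (x y : T) :
  (A #= `I_n)%card -> (n <= 1)%N -> A x -> A y -> x = y.
Proof.
case/card_set_bijP => f [fA f_inj _] n1 Ax Ay.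
apply: f_inj; rewrite ?inE //.
have := fA x Ax; have := fA y Ay; rewrite /=.
by case: n n1 {fA} => [|[|]] //= _; case: (f x) (f y) => [|?] [|?].
Qed.

(** In each copy some edge crosses the boundary of the triangle cluster at least twice and so
    contributes at least 1; contributions to different clusters add up. *)
Lemma bipyramids_crossings (R : realType) (k : nat) (D : drawing R (bipyramid_clusters k))
    (beta : nat) : zero_beta_zero_drawing D beta -> (k <= beta)%N.
Proof.
move=> [D_drawing D_planar [c [cE ->]] _].
have crossed (j : 'I_k) : exists e, (1 < c e (Some j))%N.
  apply: contrapT => /forallNP c1.
  pose w (i : 'I_4) : vertex (bipyramid_clusters k) := Some (j, i).
  pose a (i : 'I_3) := w (widen_ord (isT : 3 <= 4)%N i).
  apply: (@no_bipyramid_cluster R _ D D_drawing D_planar (Some j) _ None (w ord_max) a).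
  - move=> e z z' ez Jz ez' Jz'; apply: (card_eq_le1 (cE e (Some j))) => //.
    by rewrite leqNgt; apply/negP; exact: c1.
  - by move=> i i' [] e; apply: val_inj.
  - by [].
  - by rewrite bipyramids_cluster.
  - by rewrite bipyramids_cluster /= eqxx.
  - by move=> i; rewrite bipyramids_cluster /= eqxx /=; exact: ltn_ord.
  - by case=> m m3; rewrite /adj /=.
  - by move=> i /=; rewrite eqxx -val_eqE /= gtn_eqF.
  - by move=> i i' ii' /=; rewrite eqxx.
rewrite exchange_big /= -[k in (k <= _)%N]card_ord -sum1_card.
(* The contribution of the root is dropped, and the remaining clusters are indexed by the copies. *)
rewrite (bigID (fun mu : option 'I_k => mu == None)) /=.
apply: leq_trans (leq_addl _ _).
rewrite [X in (_ <= X)%N](reindex_omap (@Some 'I_k) id) /=; last by case.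
rewrite [X in (_ <= X)%N](eq_bigl xpredT); last by move=> j; rewrite eqxx.
apply: leq_sum => j _; have [e ce] := crossed j.
by rewrite (bigD1 e) //= (leq_trans _ (leq_addr _ _)) // half_gt0.
Qed.

Theorem theorem10 (R : realType) :
  exists F : nat -> clustered_graph,
    [/\ (forall i : nat, [/\ c_connected (F i), flat (F i) & planar R (F i)]),
        (forall N : nat, exists i : nat, (N <= #|vertex (F i)|)%N)
      & exists (c : R) (n0 : nat), 0 < c /\
          forall i : nat, (n0 <= #|vertex (F i)|)%N ->
          forall (D : drawing R (F i)) (beta : nat),
            zero_beta_zero_drawing D beta ->
            c * #|vertex (F i)|%:R <= beta%:R].
Proof.
(* The shift guarantees at least one copy, so that the bound holds from [n0 = 0] on. *)
exists (fun i => bipyramid_clusters i.+1); split=> [i|N|].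
- split; [exact: bipyramids_c_connected|exact: bipyramids_flat|exact: bipyramids_planar].
- by exists N; rewrite bipyramids_card; lia.
(* With k >= 1 copies the graph has 4k + 1 <= 5k vertices, while [beta] is at least k. *)
exists 5^-1, 0%N; split; first by rewrite invr_gt0.
move=> i _ D beta /bipyramids_crossings i_beta.
rewrite ler_pdivrMl // -natrM ler_nat bipyramids_card.
by apply: leq_trans (leq_mul (leqnn 5) i_beta); lia.
Qed.
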